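(* For $k\in\mathbb N=\{1,2,3,\dots\}$ put $$\tau_k:=\frac{3\cdot 4^{k}}{2\cdot 4^{k}+1},\qquad \theta_k:=\frac{3\,(4^{k+1}-1)}{2\cdot 4^{k+1}+1},\qquad \zeta_k:=\frac{3\,(2\cdot 4^{k}-1)}{4^{k+1}-1},$$ so that $\tau_k<\theta_k<\zeta_k<\tau_{k+1}$ for all $k\in\mathbb N$. Let $\tau>0$ be a delay and let $x$ be the solution of the retarded switching problem with delay $\tau$ and critical set $K=\{0,1\}$ described in the context. Then for every $k\in\mathbb N$: (1) if $\tau=\tau_k$, the solution is periodic and has $4k+2$ switchings on the least period; (2) if $\tau_k<\tau<\theta_k$, the solution is periodic and has $2k+4$ switchings on the least period; (3) if $\tau=\theta_k$, the solution goes to $-\infty$ after $2k+5$ switchings; (4) if $\theta_k<\tau<\zeta_k$, the solution is periodic and has $2k+6$ switchings on the least period; (5) if $\tau=\zeta_k$, the solution goes to $-\infty$ after $4k+5$ switchings; (6) if $\zeta_k<\tau<\tau_{k+1}$, the solution is periodic and has $2k+4$ switchings on the least period.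
   Context: The retarded switching problem. Fix a delay $\tau>0$ and the critical set $K=\{0,1\}\subset\mathbb R$. There are two base equations, $\dot x(t)=(-1)^{\kappa-1}$ with $\kappa\in\{1,2\}$, i.e. $\dot x=1$ (number $\kappa=1$) and $\dot x=-1$ (number $\kappa=2$). The initial data are a continuous function $\varphi:[-\tau,0]\to\mathbb R$ with $\varphi(0)=0$ and $\varphi(t)\notin\{0,1\}$ for $-\tau\le t<0$, and the initial number $\kappa(0)=1$. The solution is the continuous function $x:[-\tau,\infty)\to\mathbb R$ with $x=\varphi$ on $[-\tau,0]$ which for $t\ge 0$ follows the currently active base equation, starting with $\kappa=1$; the active equation is replaced by the other one exactly at each instant $t$ for which $x(t-\tau)\in\{0,1\}$. Such an instant $t$ is called a switching. Every instant $s\ge0$ with $x(s)\in\{0,1\}$, including $s=0$ and including those at which the graph of $x$ only touches the level $0$ or $1$ at a turning point without crossing it, causes one switching at time $s+\tau$, and there are no other switchings. (Thus the first switching is at $t=\tau$.) The restriction of $x$ to $[0,\infty)$ does not depend on the choice of $\varphi$. Terminology. ''Periodic'' means that there is $T>0$ with $x(t+T)=x(t)$ for all $t\ge0$. The ''number of switchings on the least period'' is the number of switching instants in $(0,T]$, where $T$ is the least such period. ''Goes to $-\infty$ after $N$ switchings'' means that there are exactly $N$ switching instants in total and $x(t)\to-\infty$ as $t\to\infty$. *)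

(* Defs.v *)
From Stdlib Require Import Reals Ensembles Finite_sets.
From Coquelicot Require Import Coquelicot.
Open Scope R_scope.

Definition critical (y : R) : Prop := y = 0 \/ y = 1.

Definition initial_function (tau : R) (phi : R -> R) : Prop :=
  continuous_on (fun t => - tau <= t <= 0) phi /\
  phi 0 = 0 /\
  (forall t, - tau <= t < 0 -> ~ critical (phi t)).

Definition switching (tau : R) (x : R -> R) (t : R) : Prop :=
  0 <= t /\ critical (x (t - tau)).

(* [x] is the solution on [-tau, +oo) and [kappa t] is the number of the
   equation active at time [t >= 0]; the values of [x] before [-tau] and of
   [kappa] before [0] are irrelevant.  [kappa] is normalized so that at a
   switching instant it already has its new value: 3 - 1 = 2 and 3 - 2 = 1. *)
Record follows (tau : R) (phi x : R -> R) (kappa : R -> nat) : Prop := {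
  follows_history : forall t, - tau <= t <= 0 -> x t = phi t;
  follows_continuous : continuous_on (fun t => - tau <= t) x;
  follows_number : forall t, 0 <= t -> kappa t = 1%nat \/ kappa t = 2%nat;
  follows_start : kappa 0 = 1%nat;
  follows_no_switch : forall s t, 0 <= s <= t ->
    (forall r, s < r <= t -> ~ switching tau x r) -> kappa t = kappa s;
  follows_switch : forall t, switching tau x t ->
    at_left t (fun s => kappa t = (3 - kappa s)%nat);
  follows_equation : forall t, 0 < t -> ~ switching tau x t ->
    is_derive x t ((-1) ^ (kappa t - 1)) }.

Definition is_solution (tau : R) (phi x : R -> R) : Prop :=
  exists kappa : R -> nat, follows tau phi x kappa.

Definition is_period (x : R -> R) (T : R) : Prop :=
  0 < T /\ forall t, 0 <= t -> x (t + T) = x t.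

Definition is_least_period (x : R -> R) (T : R) : Prop :=
  is_period x T /\ forall T', is_period x T' -> T <= T'.

Definition periodic_with_switchings (tau : R) (x : R -> R) (N : nat) : Prop :=
  exists T, is_least_period x T /\
    cardinal R (fun t => 0 < t <= T /\ switching tau x t) N.

Definition goes_to_minus_infinity_after (tau : R) (x : R -> R) (N : nat)
  : Prop :=
  cardinal R (switching tau x) N /\ is_lim x p_infty m_infty.

Definition tau_ (k : nat) : R := 3 * 4 ^ k / (2 * 4 ^ k + 1).
Definition theta_ (k : nat) : R :=
  3 * (4 ^ (k + 1) - 1) / (2 * 4 ^ (k + 1) + 1).
Definition zeta_ (k : nat) : R :=
  3 * (2 * 4 ^ k - 1) / (4 ^ (k + 1) - 1).

(* Main.v *)
Require Import Defs.
From Stdlib Require Import Reals.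
Open Scope R_scope.
From Coquelicot Require Import Coquelicot.
From Stdlib Require Import Ensembles Finite_sets List Lra Lia.
From Stdlib Require Import FunctionalExtensionality PropExtensionality.
Import ListNotations.

(** Between switchings the solution is affine with slope 1 or -1, and its future
    is determined by its position, its slope and the critical instants of the
    last [tau] time units, which wait in a queue until they cause a switching.
    The problem is thus an event-driven machine whose events are the meetings
    with the levels 0 and 1 and the switchings, and the theorem is a computation
    of its runs.

    After its first peak, at height [tau], the solution oscillates around the
    level 1.  If a turning point at distance [A] from the level was preceded by
    a crossing of that level [A] time units earlier, with nothing else waiting,
    the next turning point comes [tau - A] later, on the other side, at distance
    [tau - 2 * A].  The map [A |-> tau - 2 * A] has the fixed point [tau / 3] and
    multiplies deviations from it by -2 ([swings]).  Hence the peaks have heights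
    [P_i = tau / 3 - 4 ^ i * a] above the level 1, with [a = 1 - 2 * tau / 3]
    ([peak]), and the valleys between them have the depths
    [V_i = tau - 2 * P_i], which increase.  This goes on until a peak fails to
    reach the level 1 or a valley reaches the level 0.  The four thresholds are
    the zeros of the quantities that decide what happens then
    ([threshold_gaps]): up to positive factors,
    - [tau - tau_ k] is [P_k],
    - [tau - theta_ k] is the height [1 - tau + 4 * P_k] of the peak that follows
      a valley of depth [V_k > 1],
    - [zeta_ k - tau] is [V_k - 1], and
    - [tau - tau_ (k + 1)] is [P_(k+1) = 4 * P_k - tau].

    Off the thresholds, a few more events bring the machine back to its initial
    state ([return_below_theta], [return_above_theta], [return_above_zeta]), so
    the solution is periodic.  For [tau = tau_ k] the last peak touches the level
    1 from below, and the machine is then in its initial state seen through the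
    reflection [x |-> 1 - x], so two mirrored halves make a period
    ([half_period]).  For [tau = theta_ k] a touching of 0 adds one switching and
    the solution ends up falling with an empty queue ([escape_at_theta]).  For
    [tau = zeta_ k] a valley touches 0; the solution then oscillates around 0
    with the amplitudes [V_0, P_1, V_1, ..., P_k, V_k = 1] and falls forever
    afterwards ([escape_at_zeta]).

    The period found is the least one because the height [tau] of the first peak
    is reached only once in it ([starting_periodic]). *)

(** * Motions: affine between switchings *)

(** The part of the dynamics that does not mention the initial data, with the
    active slope [v] in the place of the number of the active equation.  In this
    form it is visibly invariant under translations of time. *)
Record motion (tau : R) (x v : R -> R) : Prop := {
  motion_line : forall t t', 0 <= t < t' ->
    (forall r, t < r < t' -> ~ switching tau x r) ->
    forall r, t <= r <= t' -> x r = x t + v t * (r - t);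
  motion_keep : forall t t', 0 <= t < t' ->
    (forall r, t < r < t' -> ~ switching tau x r) ->
    ~ switching tau x t' -> v t' = v t;
  motion_flip : forall t t', 0 <= t < t' ->
    (forall r, t < r < t' -> ~ switching tau x r) ->
    switching tau x t' -> v t' = - v t }.

Arguments motion_line {tau x v}.
Arguments motion_keep {tau x v}.
Arguments motion_flip {tau x v}.

Lemma solution_continuous (tau : R) (x : R -> R) :
  0 < tau -> continuous_on (fun t => - tau <= t) x ->
  forall t, 0 <= t -> continuous x t.
Proof.
  intros Htau Hc t Ht P HP.
  destruct (Hc t ltac:(lra) P HP) as [e He].
  assert (Hd : 0 < Rmin e tau) by (apply Rmin_pos; [apply cond_pos | lra]).
  exists (mkposreal _ Hd); intros s Hs.
  assert (Hb : Rabs (s - t) < Rmin e tau) by exact Hs.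
  assert (H1 := Rmin_l e tau). assert (H2 := Rmin_r e tau).
  apply He.
  - change (Rabs (s - t) < e); lra.
  - apply Rabs_def2 in Hb; lra.
Qed.

Lemma motion_of_follows (tau : R) (phi x : R -> R) (kappa : R -> nat) :
  0 < tau -> follows tau phi x kappa ->
  motion tau x (fun t => (-1) ^ (kappa t - 1)).
Proof.
  intros Htau Hf.
  assert (Hk : forall t t', 0 <= t < t' ->
    (forall r, t < r < t' -> ~ switching tau x r) ->
    forall s, t <= s < t' -> kappa s = kappa t).
  { intros t t' Ht Hs s Hr.
    apply (follows_no_switch _ _ _ _ Hf); [lra |].
    intros r Hr'; apply Hs; lra. }
  split.
  - intros t t' Ht Hs r Hr.
    destruct (Req_dec r t) as [-> | Hne]; [ring |].
    destruct (MVT_gen x t r (fun _ => (-1) ^ (kappa t - 1))) as (c & _ & Hc).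
    + intros s; rewrite Rmin_left, Rmax_right by lra; intros Hb.
      rewrite <- (Hk t t' Ht Hs s) by lra.
      apply (follows_equation _ _ _ _ Hf); [lra | apply Hs; lra].
    + intros s; rewrite Rmin_left, Rmax_right by lra; intros Hb.
      apply continuity_pt_filterlim.
      apply (solution_continuous tau x Htau (follows_continuous _ _ _ _ Hf)).
      lra.
    + lra.
  - intros t t' Ht Hs Hn.
    rewrite (follows_no_switch _ _ _ _ Hf t t'); [reflexivity | lra |].
    intros r Hr. destruct (Req_dec r t') as [-> | Hne]; [exact Hn |].
    apply Hs; lra.
  - intros t t' Ht Hs Hsw.
    destruct (follows_switch _ _ _ _ Hf t' Hsw) as [e He].
    assert (He0 := cond_pos e).
    (* an instant before [t'] late enough for the flip and not before [t] *)
    set (s := Rmax t (t' - e / 2)).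
    assert (Hs1 : t <= s) by apply Rmax_l.
    assert (Hs2 : t' - e / 2 <= s) by apply Rmax_r.
    assert (Hs3 : s < t') by (apply Rmax_lub_lt; lra).
    assert (E : kappa t' = (3 - kappa s)%nat).
    { apply He; [| exact Hs3].
      change (Rabs (s - t') < e). apply Rabs_def1; lra. }
    rewrite E, (Hk t t' Ht Hs s) by lra.
    destruct (follows_number _ _ _ _ Hf t) as [-> | ->];
      [lra | simpl; lra | simpl; lra].
Qed.

(** * The event-driven machine *)

Definition family := (R -> R) -> (R -> R) -> Prop.

Definition motions (tau : R) (F : family) : Prop :=
  (exists x v, F x v) /\ (forall x v, F x v -> motion tau x v).

(** What is known at time [t] of all members [(x, v)] of [F]: [W] is the queue of
    critical instants, oldest first, that have not yet caused their switching,
    and [n] counts the switchings so far.  A whole family is followed, instead of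
    one motion, so that running the machine also shows in [state_agree] that its
    members coincide; applied to a motion and its translates, this gives
    periodicity without a separate uniqueness theorem.  [state_bound] is what
    makes a period the least one. *)
Record state (tau : R) (F : family)
    (t y d : R) (W : list R) (n : nat) : Prop := {
  state_time : 0 <= t;
  state_position : forall x v, F x v -> x t = y;
  state_speed : forall x v, F x v -> v t = d;
  state_queue : forall x v, F x v ->
    forall s, t - tau < s <= t /\ critical (x s) <-> In s W;
  state_count : forall x v, F x v ->
    cardinal R (fun s => 0 < s <= t /\ switching tau x s) n;
  state_bound : forall x v, F x v -> forall s, tau < s <= t -> x s < tau;
  state_agree : forall x v x' v', F x v -> F x' v' ->
    forall s, 0 <= s <= t -> x s = x' s }.

Arguments state_time {tau F t y d W n}.
Arguments state_position {tau F t y d W n}.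
Arguments state_speed {tau F t y d W n}.
Arguments state_queue {tau F t y d W n}.
Arguments state_count {tau F t y d W n}.
Arguments state_bound {tau F t y d W n}.
Arguments state_agree {tau F t y d W n}.

Lemma ensemble_ext (A B : Ensemble R) : (forall s, A s <-> B s) -> A = B.
Proof.
  intros H; apply functional_extensionality; intros s.
  apply propositional_extensionality, H.
Qed.

(** The queue decides where switchings occur up to [tau] after [t], since the
    delayed instants then still lie in its window; so the motion is affine up to
    the first of them, and an instant leaves the queue exactly when it switches
    the slope. *)
Lemma state_step (tau : R) (F : family)
    (t t' y y' d d' : R) (W W' : list R) (n n' : nat) :
  motions tau F -> state tau F t y d W n ->
  t < t' <= t + tau -> (forall w, In w W -> t' <= w + tau) ->
  y' = y + d * (t' - t) ->
  (forall r, t < r < t' -> ~ critical (y + d * (r - t))) ->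
  t' <= tau \/ (y <= tau /\ y' < tau) ->
  (forall s, In s W' <->
    (In s W /\ t' - tau < s) \/ (s = t' /\ critical y')) ->
  (In (t' - tau) W /\ d' = - d /\ n' = S n) \/
  (~ In (t' - tau) W /\ d' = d /\ n' = n) ->
  state tau F t' y' d' W' n'.
Proof.
  intros [_ HF] HS Ht HW Hy Hcr Hb HW' Hd.
  assert (H0 := state_time HS).
  assert (Hsw : forall x v, F x v -> forall r, t < r <= t' ->
    (switching tau x r <-> In (r - tau) W)).
  { intros x v Hx r Hr. split.
    - intros [_ Hc]. apply (state_queue HS x v Hx). split; [lra | exact Hc].
    - intros Hin. split; [lra |].
      apply (state_queue HS x v Hx) in Hin. apply Hin. }
  assert (Hno : forall x v, F x v -> forall r, t < r < t' -> ~ switching tau x r).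
  { intros x v Hx r Hr Hs. apply (Hsw x v Hx) in Hs; [| lra].
    apply HW in Hs. lra. }
  assert (Hlin : forall x v, F x v -> forall r, t <= r <= t' -> x r = y + d * (r - t)).
  { intros x v Hx r Hr.
    rewrite (motion_line (HF x v Hx) t t' ltac:(lra) (Hno x v Hx) r Hr).
    rewrite (state_position HS x v Hx), (state_speed HS x v Hx).
    reflexivity. }
  assert (Hy' : forall x v, F x v -> x t' = y').
  { intros x v Hx. rewrite (Hlin x v Hx t') by lra. lra. }
  split.
  - lra.
  - exact Hy'.
  - intros x v Hx.
    rewrite <- (state_speed HS x v Hx) in Hd.
    destruct Hd as [(Hin & -> & _) | (Hin & -> & _)].
    + apply (motion_flip (HF x v Hx) t t' ltac:(lra) (Hno x v Hx)).
      apply (Hsw x v Hx); [lra | exact Hin].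
    + apply (motion_keep (HF x v Hx) t t' ltac:(lra) (Hno x v Hx)).
      intros Hs; apply Hin, (Hsw x v Hx); [lra | exact Hs].
  - intros x v Hx s. rewrite HW', <- (state_queue HS x v Hx).
    split.
    + intros [Hs Hc].
      destruct (Rle_dec s t) as [Hle | Hgt]; [left; repeat split; auto; lra |].
      right. destruct (Req_dec s t') as [-> | Hne].
      * split; [reflexivity |]. rewrite <- (Hy' x v Hx). exact Hc.
      * exfalso. apply (Hcr s); [lra |]. rewrite <- (Hlin x v Hx) by lra. exact Hc.
    + intros [[[Hs Hc] Hlt] | [-> Hc]].
      * split; [lra | exact Hc].
      * split; [lra |]. rewrite (Hy' x v Hx). exact Hc.
  - intros x v Hx.
    assert (Hcard := state_count HS x v Hx).
    destruct Hd as [(Hin & _ & ->) | (Hin & _ & ->)].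
    + rewrite (ensemble_ext _
        (Ensembles.Add R (fun s => 0 < s <= t /\ switching tau x s) t')).
      * apply card_add; [exact Hcard |]. unfold Ensembles.In. lra.
      * intros s; split.
        -- intros [Hs1 Hs2].
           destruct (Req_dec s t') as [-> | Hne]; [right; constructor |].
           left. unfold Ensembles.In. split; [| exact Hs2].
           destruct (Rle_dec s t); [lra |].
           exfalso; apply (Hno x v Hx s); [lra | exact Hs2].
        -- intros Hs; destruct Hs as [s Hs | s Hs].
           ++ destruct Hs; split; [lra | assumption].
           ++ destruct Hs. split; [lra |]. apply (Hsw x v Hx); [lra | exact Hin].
    + rewrite (ensemble_ext _ (fun s => 0 < s <= t /\ switching tau x s));
        [exact Hcard |].
      intros s; split; intros [Hs1 Hs2]; (split; [| exact Hs2]); [| lra].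
      destruct (Rle_dec s t); [lra | exfalso].
      destruct (Req_dec s t') as [-> | Hne].
      * apply Hin, (Hsw x v Hx); [lra | exact Hs2].
      * apply (Hno x v Hx s); [lra | exact Hs2].
  - intros x v Hx s Hs.
    destruct (Rle_dec s t) as [Hle | Hgt];
      [apply (state_bound HS x v Hx); lra |].
    destruct Hb as [Hb | [Hb1 Hb2]]; [lra |].
    rewrite (Hlin x v Hx) by lra.
    (* an affine function is below the larger of its end values *)
    destruct (Rle_dec d 0); nra.
  - intros x v x1 v1 Hx Hx1 s Hs.
    destruct (Rle_dec s t) as [Hle | Hgt].
    + apply (state_agree HS x v x1 v1 Hx Hx1). lra.
    + rewrite (Hlin x v Hx), (Hlin x1 v1 Hx1) by lra. reflexivity.
Qed.

(** A critical level is met before the oldest waiting instant is due. *)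
Lemma cross (tau : R) (F : family)
    (t t' y y' d : R) (W W' : list R) (n : nat) :
  motions tau F -> state tau F t y d W n ->
  t < t' <= t + tau -> (forall w, In w W -> t' < w + tau) ->
  y' = y + d * (t' - t) -> critical y' ->
  (forall r, t < r < t' -> ~ critical (y + d * (r - t))) ->
  t' <= tau \/ (y <= tau /\ y' < tau) ->
  W' = W ++ [t'] ->
  state tau F t' y' d W' n.
Proof.
  intros HF HS Ht HW Hy Hc Hcr Hb ->.
  apply (state_step tau F t t' y y' d d W (W ++ [t']) n n HF HS Ht); auto.
  - intros w Hw; apply HW in Hw; lra.
  - intros s; rewrite in_app_iff; split.
    + intros [Hs | [<- | []]]; [left | right; auto].
      split; [exact Hs |]. apply HW in Hs; lra.
    + intros [[Hs _] | [-> _]]; [left; exact Hs | right; left; reflexivity].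
  - right; repeat split. intros Hin; apply HW in Hin; lra.
Qed.

Lemma queue_window (tau : R) (F : family)
    (t y d : R) (W : list R) (n : nat) :
  motions tau F -> state tau F t y d W n ->
  forall w, In w W -> t - tau < w <= t.
Proof.
  intros [(x & v & Hx) _] HS w Hw.
  apply (state_queue HS x v Hx) in Hw; apply Hw.
Qed.

(** The oldest waiting instant is due.  If the motion is at a critical level at
    that moment, it touches the level without crossing it, and the touching joins
    the queue. *)
Lemma turn (tau : R) (F : family)
    (t t' y y' d d' w : R) (W W' : list R) (n : nat) :
  motions tau F -> state tau F t y d (w :: W) n ->
  t' = w + tau -> (forall w', In w' W -> w < w') ->
  y' = y + d * (t' - t) -> d' = - d ->
  (forall r, t < r < t' -> ~ critical (y + d * (r - t))) ->
  t' <= tau \/ (y <= tau /\ y' < tau) ->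
  (~ critical y' /\ W' = W) \/ (critical y' /\ W' = W ++ [t']) ->
  state tau F t' y' d' W' (S n).
Proof.
  intros HF HS Ht HW Hy Hd Hcr Hb HW'.
  assert (Hw := queue_window tau F t y d (w :: W) n HF HS).
  assert (Hw0 := Hw w (or_introl eq_refl)).
  apply (state_step tau F t t' y y' d d' (w :: W) W' n (S n) HF HS); auto.
  - lra.
  - intros s [<- | Hs]; [| apply HW in Hs]; lra.
  - assert (HWW : forall s, In s W <-> In s (w :: W) /\ t' - tau < s).
    { intros s; split.
      - intros Hs; split; [right; exact Hs | apply HW in Hs; lra].
      - intros [[<- | Hs] Hlt]; [lra | exact Hs]. }
    intros s. rewrite <- HWW.
    destruct HW' as [[Hc ->] | [Hc ->]].
    + tauto.
    + rewrite in_app_iff. simpl. intuition.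
  - left. split; [left; lra | auto].
Qed.

(** * Oscillation around a critical level *)

(** [e] points from the critical level [c] away from the other one.  The level 1
    with [e = 1] and the level 0 with [e = -1] are exchanged by the reflection
    [x |-> 1 - x], under which the dynamics is invariant. *)
Definition outward (c e : R) : Prop := (c = 1 /\ e = 1) \/ (c = 0 /\ e = -1).

(** A turning point at distance [A] from the level [c], on its [e]-side, reached
    from a crossing of [c] that is the only waiting instant. *)
Definition swing (tau : R) (F : family) (c e t A : R) (n : nat) : Prop :=
  state tau F t (c + e * A) (- e) [t - A] n.

Ltac same_instants := repeat (apply (f_equal2 cons); [lra |]); reflexivity.

(** Discharges the side conditions of an event, which are linear once the queue
    and the level are explicit. *)
Ltac settle := intros;
  repeat match goal with
  | H : outward _ _ |- _ => destruct H
  | H : In _ _ |- _ => simpl in H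
  | H : False |- _ => destruct H
  | H : _ \/ _ |- _ => destruct H
  | H : _ /\ _ |- _ => destruct H
  end; subst; simpl; unfold critical in *;
  try lra; try (intros [?|?]; lra); try same_instants;
  try (left; split; [intros [?|?]; lra | same_instants]);
  try (right; split; [first [left; lra | right; lra] | same_instants]).

(** The arguments after [HS] are the time, the position, for a turn the slope,
    and the queue after the event. *)
Ltac cross_at HF HS t' y' W' :=
  eapply (cross _ _ _ t' _ y' _ _ W' _ HF) in HS; [| settle ..].
Ltac turn_at HF HS t' y' d' W' :=
  eapply (turn _ _ _ t' _ y' _ d' _ _ W' _ HF) in HS; [| settle ..].

(** From the other level, with no other instant waiting, the motion passes [c]
    after one time unit and turns after [tau].  A rise from 0 ends at the height
    [tau], which [state_bound] admits only at time [tau]. *)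
Lemma leave (tau : R) (F : family) (c e t : R) (n : nat) :
  motions tau F -> 1 < tau < 2 -> outward c e -> t = 0 \/ c = 0 ->
  state tau F t (1 - c) e [t] n ->
  swing tau F c e (t + tau) (tau - 1) (S n).
Proof.
  intros HF Htau Hce Ht HS.
  cross_at HF HS (t + 1) c [t; t + 1].
  turn_at HF HS (t + tau) (c + e * (tau - 1)) (- e) [t + 1].
  unfold swing. replace (t + tau - (tau - 1)) with (t + 1) by ring. exact HS.
Qed.

(** The next switching is due [tau] after the crossing of [c], at
    [t - A + tau]; by then the motion has used [A] to come back to [c] and has
    [tau - 2 * A] left to move away.  The inner turning point must stay short of
    the other level, at distance 1. *)
Lemma outer_to_inner (tau : R) (F : family) (c e t A : R) (n : nat) :
  motions tau F -> outward c e -> 0 < A -> 0 < tau - 2 * A < 1 ->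
  c + e * A <= tau -> 1 < tau ->
  swing tau F c e t A n ->
  swing tau F c (- e) (t + tau - A) (tau - 2 * A) (S n).
Proof.
  intros HF Hce HA HB Hb Htau HS. unfold swing in HS.
  cross_at HF HS (t + A) c [t - A; t + A].
  turn_at HF HS (t + tau - A) (c + - e * (tau - 2 * A)) (- - e) [t + A].
  unfold swing. replace (t + tau - A - (tau - 2 * A)) with (t + A) by ring. exact HS.
Qed.

Lemma inner_to_outer (tau : R) (F : family) (c e t A : R) (n : nat) :
  motions tau F -> outward c e -> 0 < A < 1 -> 0 < tau - 2 * A ->
  c + e * (tau - 2 * A) < tau -> 1 < tau ->
  swing tau F c (- e) t A n ->
  swing tau F c e (t + tau - A) (tau - 2 * A) (S n).
Proof.
  intros HF Hce HA HB Hb Htau HS. unfold swing in HS.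
  cross_at HF HS (t + A) c [t - A; t + A].
  turn_at HF HS (t + tau - A) (c + e * (tau - 2 * A)) (- e) [t + A].
  unfold swing. replace (t + tau - A - (tau - 2 * A)) with (t + A) by ring. exact HS.
Qed.

(** Every second amplitude: [delta] is the deviation of the first one from the
    fixed point [tau / 3] of [A |-> tau - 2 * A], and two steps multiply it by
    [(-2) ^ 2]. *)
Definition amplitude (tau delta : R) (i : nat) : R := tau / 3 + 4 ^ i * delta.

Lemma swings (tau : R) (F : family) (c e t delta : R) (n m : nat) :
  motions tau F -> outward c e -> 1 < tau ->
  (forall i, (i < m)%nat -> 0 < amplitude tau delta i /\
     0 < tau - 2 * amplitude tau delta i < 1 /\
     0 < amplitude tau delta (S i) /\
     c + e * amplitude tau delta i <= tau /\
     c + e * amplitude tau delta (S i) < tau) ->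
  swing tau F c e t (amplitude tau delta 0) n ->
  exists t', t <= t' /\ swing tau F c e t' (amplitude tau delta m) (n + 2 * m).
Proof.
  intros HF Hce Htau. induction m as [| m IH]; intros Hi HS.
  - exists t. split; [lra |]. replace (n + 2 * 0)%nat with n by lia. exact HS.
  - destruct IH as (t' & Ht' & HS'); [intros i Hlt; apply Hi; lia | exact HS |].
    destruct (Hi m ltac:(lia)) as (H1 & H2 & H3 & H4 & H5).
    assert (E : amplitude tau delta (S m) =
      tau - 2 * (tau - 2 * amplitude tau delta m)).
    { unfold amplitude. simpl. field. }
    rewrite E in *.
    apply outer_to_inner in HS'; try assumption.
    apply inner_to_outer in HS'; try assumption; try lra.
    replace (n + 2 * S m)%nat with (S (S (n + 2 * m))) by lia.
    eexists. split; [| exact HS'].  lra.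
Qed.

(** * Peaks around the level 1 *)

(** The height above 1 of the [i]-th peak; the first one is at [tau].  For
    [tau < 3 / 2] the deviation from [tau / 3] is negative and the heights
    decrease until they leave the oscillation. *)
Definition peak (tau : R) : nat -> R := amplitude tau (2 * tau / 3 - 1).

Lemma peak_0 (tau : R) : peak tau 0 = tau - 1.
Proof. unfold peak, amplitude; simpl; field. Qed.

Lemma peak_S (tau : R) (i : nat) : peak tau (S i) = 4 * peak tau i - tau.
Proof. unfold peak, amplitude; simpl; field. Qed.

Lemma peak_lt (tau : R) (i j : nat) :
  tau < 3 / 2 -> (i < j)%nat -> peak tau j < peak tau i.
Proof.
  intros Htau Hij. unfold peak, amplitude.
  assert (4 ^ i < 4 ^ j) by (apply Rlt_pow; [lra | exact Hij]). nra.
Qed.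

Lemma peak_le (tau : R) (i j : nat) :
  tau < 3 / 2 -> (i <= j)%nat -> peak tau j <= peak tau i.
Proof.
  intros Htau Hij. destruct (Nat.eq_dec i j) as [-> | Hne]; [lra |].
  apply Rlt_le, peak_lt; [exact Htau | lia].
Qed.

Lemma swings_to_peak (tau : R) (F : family) (c e t : R) (n m : nat) :
  motions tau F -> 1 < tau < 3 / 2 -> outward c e -> t = 0 \/ c = 0 ->
  0 < peak tau m ->
  state tau F t (1 - c) e [t] n ->
  exists t', t < t' /\ swing tau F c e t' (peak tau m) (n + 2 * m + 1).
Proof.
  intros HF Htau Hce Ht Hm HS.
  apply leave in HS; [| assumption | lra | assumption | assumption].
  destruct (swings tau F c e (t + tau) (2 * tau / 3 - 1) (S n) m) as (t' & Ht' & HS').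
  - exact HF.
  - exact Hce.
  - lra.
  - intros i Hi. fold (peak tau).
    assert (H0 := peak_0 tau). assert (HSi := peak_S tau i).
    assert (HSm : peak tau m <= peak tau (S i)) by (apply peak_le; [lra | lia]).
    assert (H1 : peak tau (S i) < peak tau i) by (apply peak_lt; [lra | lia]).
    assert (Hi0 : peak tau i <= peak tau 0) by (apply peak_le; [lra | lia]).
    destruct Hce as [[-> ->] | [-> ->]]; lra.
  - fold (peak tau). rewrite peak_0. exact HS.
  - exists t'. split; [lra |].
    replace (n + 2 * m + 1)%nat with (S n + 2 * m)%nat by lia. exact HS'.
Qed.

(** * The last events before a return or an escape *)

(** A peak of height 0 means that the motion arrives at [c] from the inner side
    just as it is switched.  It touches [c], moves back, and the touching is the
    only instant that waits: this is the initial situation with the two levels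
    exchanged. *)
Lemma half_period (tau : R) (F : family) (c e t : R) (n m : nat) :
  motions tau F -> 1 < tau < 3 / 2 -> outward c e -> t = 0 \/ c = 0 ->
  peak tau (S m) = 0 ->
  state tau F t (1 - c) e [t] n ->
  exists t', t < t' /\ state tau F t' c (- e) [t'] (n + 2 * S m + 1).
Proof.
  intros HF Htau Hce Ht Hm HS.
  assert (Hlt := peak_lt tau m (S m) ltac:(lra) ltac:(lia)).
  assert (Hle : peak tau m <= tau - 1).
  { rewrite <- peak_0. apply peak_le; [lra | lia]. }
  rewrite peak_S in Hm.
  destruct (swings_to_peak tau F c e t n m) as (t1 & Ht1 & HS1); auto; [lra |].
  assert (E : peak tau m = tau / 4) by lra. rewrite E in HS1.
  apply outer_to_inner in HS1; [| assumption | assumption | lra | lra | settle | lra].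
  unfold swing in HS1. exists (t1 + 5 * tau / 4). split; [lra |].
  replace (n + 2 * S m + 1)%nat with (S (S (n + 2 * m + 1))) by lia.
  apply (turn tau F _ _ _ _ _ _ _ [] _ _ HF HS1); settle.
Qed.

(** A valley below 0, then a peak still below 0, then a lower valley, from where
    the motion rises to 0 with an empty queue. *)
Lemma return_below_theta (tau : R) (F : family) (t P : R) (n : nat) :
  motions tau F -> 1 < tau < 3 / 2 -> 0 < P -> 1 < tau - 2 * P -> 4 * P + 1 - tau < 0 ->
  swing tau F 1 1 t P n ->
  state tau F (t + 2 * tau + 1 - 3 * P) 0 1 [t + 2 * tau + 1 - 3 * P] (n + 3).
Proof.
  intros HF Htau HP HV Hq HS. unfold swing in HS.
  replace (n + 3)%nat with (S (S (S n))) by lia.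
  cross_at HF HS (t + P) 1 [t - P; t + P].
  cross_at HF HS (t + P + 1) 0 [t - P; t + P; t + P + 1].
  turn_at HF HS (t - P + tau) (1 - (tau - 2 * P)) 1 [t + P; t + P + 1].
  turn_at HF HS (t + P + tau) (4 * P + 1 - tau) (-1) [t + P + 1].
  turn_at HF HS (t + P + 1 + tau) (4 * P - tau) 1 (@nil R).
  eapply cross; [exact HF | exact HS | settle ..].
Qed.

(** The peak after the valley below 0 touches 0.  This one more waiting instant
    turns the motion down again during its last rise, before it reaches 0. *)
Lemma escape_at_theta (tau : R) (F : family) (t P : R) (n : nat) :
  motions tau F -> 1 < tau < 3 / 2 -> 0 < P -> 4 * P + 1 - tau = 0 ->
  swing tau F 1 1 t P n ->
  state tau F (t + P + 2 * tau) (tau - 2) (-1) [] (n + 4).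
Proof.
  intros HF Htau HP Hq HS. unfold swing in HS.
  replace (n + 4)%nat with (S (S (S (S n)))) by lia.
  cross_at HF HS (t + P) 1 [t - P; t + P].
  cross_at HF HS (t + P + 1) 0 [t - P; t + P; t + P + 1].
  turn_at HF HS (t - P + tau) (1 - (tau - 2 * P)) 1 [t + P; t + P + 1].
  turn_at HF HS (t + P + tau) 0 (-1) [t + P + 1; t + P + tau].
  turn_at HF HS (t + P + 1 + tau) (-1) 1 [t + P + tau].
  eapply turn; [exact HF | exact HS | settle ..].
Qed.

(** The peak after the valley below 0 lies between 0 and 1.  Its two crossings of
    0, up and down, cause a further peak and a further valley, both below 0,
    before the motion rises to 0 with an empty queue. *)
Lemma return_above_theta (tau : R) (F : family) (t P : R) (n : nat) :
  motions tau F -> 1 < tau < 3 / 2 -> 0 < P -> 1 < tau - 2 * P -> 0 < 4 * P + 1 - tau ->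
  swing tau F 1 1 t P n ->
  state tau F (t + 13 * P + 5 - 2 * tau) 0 1 [t + 13 * P + 5 - 2 * tau] (n + 5).
Proof.
  intros HF Htau HP HV Hq HS. unfold swing in HS.
  replace (n + 5)%nat with (S (S (S (S (S n))))) by lia.
  cross_at HF HS (t + P) 1 [t - P; t + P].
  cross_at HF HS (t + P + 1) 0 [t - P; t + P; t + P + 1].
  turn_at HF HS (t - P + tau) (1 - (tau - 2 * P)) 1 [t + P; t + P + 1].
  cross_at HF HS (t + 2 * tau - 3 * P - 1) 0
    [t + P; t + P + 1; t + 2 * tau - 3 * P - 1].
  turn_at HF HS (t + P + tau) (4 * P + 1 - tau) (-1)
    [t + P + 1; t + 2 * tau - 3 * P - 1].
  cross_at HF HS (t + 5 * P + 1) 0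
    [t + P + 1; t + 2 * tau - 3 * P - 1; t + 5 * P + 1].
  turn_at HF HS (t + P + 1 + tau) (4 * P - tau) 1
    [t + 2 * tau - 3 * P - 1; t + 5 * P + 1].
  turn_at HF HS (t + 3 * tau - 3 * P - 1) (tau - 2) (-1) [t + 5 * P + 1].
  turn_at HF HS (t + 5 * P + 1 + tau) (3 * tau - 8 * P - 4) 1 (@nil R).
  eapply cross; [exact HF | exact HS | settle ..].
Qed.

(** The valley stays above 0, but the next peak stays below 1 as [4 * P < tau].
    Only its descent through 0 then waits, so that the motion falls to [- tau] and
    rises again with an empty queue. *)
Lemma return_above_zeta (tau : R) (F : family) (t P : R) (n : nat) :
  motions tau F -> 1 < tau < 3 / 2 -> 0 < P -> 0 < tau - 2 * P < 1 -> 1 + P <= tau ->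
  4 * P < tau ->
  swing tau F 1 1 t P n ->
  state tau F (t + 5 * P + 1 + 2 * tau) 0 1 [t + 5 * P + 1 + 2 * tau] (n + 3).
Proof.
  intros HF Htau HP HV HPt Hq HS.
  replace (n + 3)%nat with (S (S (S n))) by lia.
  apply outer_to_inner in HS; [| assumption | left; lra | lra ..].
  unfold swing in HS.
  turn_at HF HS (t + tau + P) (1 + 4 * P - tau) (-1) (@nil R).
  cross_at HF HS (t + 5 * P + 1) 0 [t + 5 * P + 1].
  turn_at HF HS (t + 5 * P + 1 + tau) (- tau) 1 (@nil R).
  eapply cross; [exact HF | exact HS | settle ..].
Qed.

(** A valley of depth 1 touches 0.  The crossing of 1 just before it makes a peak
    below 1, and the touching makes a valley below 0; what remains is an
    oscillation around 0. *)
Lemma oscillation_at_zeta (tau : R) (F : family) (t P : R) (n : nat) :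
  motions tau F -> 1 < tau < 3 / 2 -> tau - 2 * P = 1 ->
  swing tau F 1 1 t P n ->
  swing tau F 0 (-1) (t - P + 2 * tau) (2 - tau) (n + 3).
Proof.
  intros HF Htau HV HS. unfold swing in HS.
  replace (n + 3)%nat with (S (S (S n))) by lia.
  cross_at HF HS (t + P) 1 [t - P; t + P].
  turn_at HF HS (t - P + tau) 0 1 [t + P; t - P + tau].
  turn_at HF HS (t + P + tau) (tau - 1) (-1) [t - P + tau].
  cross_at HF HS (t + P + 2 * tau - 1) 0 [t - P + tau; t + P + 2 * tau - 1].
  unfold swing. eapply turn; [exact HF | exact HS | settle ..].
Qed.

(** The outer amplitudes around 0 are [V_i = tau - 2 * P_i], from
    [V_0 = 2 - tau] to [V_k = 1], and the inner ones are the [P_i].  At the valley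
    of depth [V_k = 1] one crossing of 0 waits; the rise that it ends has the
    length [tau - 1] and does not reach 0. *)
Lemma escape_at_zeta (tau : R) (F : family) (t : R) (n k : nat) :
  motions tau F -> 1 < tau < 3 / 2 -> tau - 2 * peak tau k = 1 ->
  swing tau F 1 1 t (peak tau k) n ->
  exists t', state tau F t' (tau - 2) (-1) [] (n + 2 * k + 4).
Proof.
  intros HF Htau HV HS.
  apply oscillation_at_zeta in HS; [| assumption ..].
  assert (Hg : forall i, amplitude tau (2 - 4 * tau / 3) i = tau - 2 * peak tau i).
  { intros i. unfold peak, amplitude. field. }
  destruct (swings tau F 0 (-1) (t - peak tau k + 2 * tau) (2 - 4 * tau / 3) (n + 3) k)
    as (t' & Ht' & HS').
  - exact HF.
  - right; lra.
  - lra.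
  - intros i Hi. rewrite !Hg.
    assert (H0 := peak_0 tau). assert (HSi := peak_S tau i).
    assert (HSm : peak tau k <= peak tau (S i)) by (apply peak_le; [lra | lia]).
    assert (H1 : peak tau (S i) < peak tau i) by (apply peak_lt; [lra | lia]).
    assert (Hi0 : peak tau i <= peak tau 0) by (apply peak_le; [lra | lia]).
    lra.
  - rewrite Hg, peak_0. replace (tau - 2 * (tau - 1)) with (2 - tau) by ring. exact HS.
  - rewrite Hg, HV in HS'. unfold swing in HS'.
    replace (n + 2 * k + 4)%nat with (S (n + 3 + 2 * k)) by lia.
    exists (t' - 1 + tau). eapply turn; [exact HF | exact HS' | settle ..].
Qed.

(** * The motions of the problem, their periodicity and their escape *)

(** Translates by a period cannot match the arbitrary initial function, so this
    remembers of it only that no critical instant but 0 is waiting. *)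
Definition starting (tau : R) (x v : R -> R) : Prop :=
  motion tau x v /\ x 0 = 0 /\ v 0 = 1 /\
  forall s, - tau < s <= 0 -> critical (x s) -> s = 0.

Lemma solution_starting (tau : R) (phi x : R -> R) :
  0 < tau -> initial_function tau phi -> is_solution tau phi x ->
  (exists v, starting tau x v) /\ ~ switching tau x 0.
Proof.
  intros Htau (_ & Hphi0 & Hphi) [kappa Hf].
  assert (Hneg : forall s, - tau <= s < 0 -> ~ critical (x s)).
  { intros s Hs. rewrite (follows_history _ _ _ _ Hf) by lra. apply Hphi, Hs. }
  split; [| intros [_ Hc]; apply (Hneg (0 - tau)); [lra | exact Hc]].
  exists (fun t => (-1) ^ (kappa t - 1)).
  split; [exact (motion_of_follows tau phi x kappa Htau Hf) |].
  repeat split.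
  - rewrite (follows_history _ _ _ _ Hf) by lra. exact Hphi0.
  - rewrite (follows_start _ _ _ _ Hf). reflexivity.
  - intros s Hs Hc. destruct (Req_dec s 0) as [-> | Hne]; [reflexivity |].
    exfalso. apply (Hneg s); [lra | exact Hc].
Qed.

Lemma starting_motions (tau : R) (x v : R -> R) :
  starting tau x v -> motions tau (starting tau).
Proof.
  intros Hx; split; [exists x, v; exact Hx | intros y w Hy; exact (proj1 Hy)].
Qed.

Lemma starting_state (tau : R) : 0 < tau -> state tau (starting tau) 0 0 1 [0] 0.
Proof.
  intros Htau. split.
  - lra.
  - intros x v (_ & H0 & _); exact H0.
  - intros x v (_ & _ & H1 & _); exact H1.
  - intros x v (_ & H0 & _ & Hc) s; split.
    + intros [Hs Hcs]. left; symmetry; apply Hc; [lra | exact Hcs].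
    + intros [<- | []]. split; [lra |]. left; exact H0.
  - intros x v _. rewrite (ensemble_ext _ (Empty_set R)); [constructor |].
    intros s; split; [intros []; lra | intros []].
  - intros; lra.
  - intros x v x' v' Hx Hx' s Hs. replace s with 0 by lra.
    destruct Hx as (_ & -> & _), Hx' as (_ & -> & _). reflexivity.
Qed.

Lemma motion_shift (tau T : R) (x v : R -> R) :
  0 <= T -> motion tau x v ->
  motion tau (fun t => x (t + T)) (fun t => v (t + T)).
Proof.
  intros HT HM.
  assert (Hsw : forall r, 0 <= r ->
    (switching tau (fun t => x (t + T)) r <-> switching tau x (r + T))).
  { intros r Hr. unfold switching. replace (r + T - tau) with (r - tau + T) by ring.
    split; (intros [_ Hc]; split; [lra | exact Hc]). }
  assert (Hno : forall t t', 0 <= t ->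
    (forall r, t < r < t' -> ~ switching tau (fun s => x (s + T)) r) ->
    forall r, t + T < r < t' + T -> ~ switching tau x r).
  { intros t t' Ht Hs r Hr Hsr. apply (Hs (r - T)); [lra |].
    apply Hsw; [lra |]. replace (r - T + T) with r by ring. exact Hsr. }
  split; intros t t' Ht Hs'; assert (Hs := Hno t t' (proj1 Ht) Hs').
  - intros r Hr.
    rewrite (motion_line HM (t + T) (t' + T) ltac:(lra) Hs (r + T)) by lra. ring.
  - intros Hn. apply (motion_keep HM); [lra | exact Hs |].
    intros Hc; apply Hn, Hsw; [lra | exact Hc].
  - intros Hc. apply (motion_flip HM); [lra | exact Hs |].
    apply Hsw; [lra | exact Hc].
Qed.

Lemma starting_shift (tau T : R) (N : nat) (x v : R -> R) :
  state tau (starting tau) T 0 1 [T] N -> starting tau x v ->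
  starting tau (fun t => x (t + T)) (fun t => v (t + T)).
Proof.
  intros HS Hx. split; [| repeat split].
  - apply motion_shift; [exact (state_time HS) | exact (proj1 Hx)].
  - rewrite Rplus_0_l. exact (state_position HS x v Hx).
  - rewrite Rplus_0_l. exact (state_speed HS x v Hx).
  - intros s Hs Hc.
    destruct (proj1 (state_queue HS x v Hx (s + T))) as [E | []];
      [split; [lra | exact Hc] | lra].
Qed.

Lemma starting_rise (tau : R) (x v : R -> R) :
  0 < tau -> starting tau x v -> forall s, 0 <= s <= tau -> x s = s.
Proof.
  intros Htau (HM & H0 & Hv & Hc) s Hs.
  rewrite (motion_line HM 0 tau ltac:(lra)) with (r := s);
    [rewrite H0, Hv; ring | | exact Hs].
  intros r Hr [_ Hcr]. apply Hc in Hcr; lra.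
Qed.

(** When all starting motions are in the initial state again at time [T], their
    translates by [T] are starting motions too, and so coincide with them.  On
    [[0, T]] the level [tau] is reached only at time [tau], because of
    [state_bound]; a period [T' < T] would bring it back at [tau + T']. *)
Lemma starting_periodic (tau T : R) (N : nat) (x v : R -> R) :
  0 < tau -> 0 < T -> state tau (starting tau) T 0 1 [T] N ->
  starting tau x v -> periodic_with_switchings tau x N.
Proof.
  intros Htau HT HS Hx.
  assert (Hshift : forall m : nat, exists w,
    starting tau (fun t => x (t + INR m * T)) w).
  { induction m as [| m [w IH]].
    - exists v. replace (fun t => x (t + INR 0 * T)) with x; [exact Hx |].
      apply functional_extensionality; intros t; simpl; f_equal; ring.
    - exists (fun t => w (t + T)).
      replace (fun t => x (t + INR (S m) * T))
        with (fun t => (fun t => x (t + INR m * T)) (t + T)).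
      + exact (starting_shift tau T N _ w HS IH).
      + apply functional_extensionality; intros t; rewrite S_INR; f_equal; ring. }
  assert (Hper : forall t, 0 <= t -> x (t + T) = x t).
  { intros t Ht.
    assert (Hm : exists m : nat, INR m * T <= t < (INR m + 1) * T).
    { destruct (nfloor_ex (t / T)) as [m Hm].
      { apply Rdiv_le_0_compat; lra. }
      exists m. replace t with (t / T * T) by (field; lra).
      split; [apply Rmult_le_compat_r | apply Rmult_lt_compat_r]; lra. }
    destruct Hm as [m Hm].
    destruct (Hshift m) as [w Hw]. destruct (Hshift (S m)) as [w' Hw'].
    assert (E := state_agree HS _ _ _ _ Hw' Hw (t - INR m * T) ltac:(lra)).
    rewrite S_INR in E.
    replace (t - INR m * T + (INR m + 1) * T) with (t + T) in E by ring.
    replace (t - INR m * T + INR m * T) with t in E by ring. exact E. }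
  exists T. split; [split; [split; assumption |] | exact (state_count HS x v Hx)].
  intros T' [HT' Hp']. apply Rnot_lt_le. intros Hlt.
  assert (Hrise := starting_rise tau x v Htau Hx).
  assert (E : x (tau + T') = tau) by (rewrite Hp' by lra; apply Hrise; lra).
  destruct (Rle_dec (tau + T') T) as [Hle | Hgt].
  - assert (Hb := state_bound HS x v Hx (tau + T') ltac:(lra)). lra.
  - replace (tau + T') with (tau + T' - T + T) in E by ring.
    rewrite Hper, Hrise in E by lra. lra.
Qed.

(** Falling below 0 with an empty queue, the motion never meets a critical level
    again, so nothing switches it any more.  The induction proceeds by delays. *)
Lemma falls_forever (tau t y : R) (N : nat) (x v : R -> R) :
  0 < tau -> y < 0 -> state tau (starting tau) t y (-1) [] N ->
  starting tau x v -> ~ switching tau x 0 -> goes_to_minus_infinity_after tau x N.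
Proof.
  intros Htau Hy HS Hx Hsw0.
  assert (H0 := state_time HS).
  assert (HM := proj1 Hx).
  assert (Hno : forall s, (s <= t \/ x s < 0) -> t - tau < s -> ~ critical (x s)).
  { intros s Hs Hlt Hc. destruct (Rle_dec s t) as [Hle | Hgt].
    - apply (state_queue HS x v Hx s). split; [lra | exact Hc].
    - destruct Hs as [Hs | Hs], Hc; lra. }
  assert (Hm : forall (m : nat) s, t <= s <= t + INR m * tau -> x s = y - (s - t)).
  { induction m as [| m IH]; intros s Hs.
    - simpl in Hs. replace s with t by lra.
      rewrite (state_position HS x v Hx). ring.
    - assert (HI := pos_INR m). rewrite S_INR in Hs.
      rewrite (motion_line HM t (t + (INR m + 1) * tau) ltac:(nra)) with (r := s);
        [| | exact Hs].
      + rewrite (state_position HS x v Hx), (state_speed HS x v Hx). ring.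
      + intros r Hr [_ Hc]. revert Hc. apply Hno; [| lra].
        destruct (Rle_dec (r - tau) t); [left; assumption |].
        right. rewrite IH; lra. }
  assert (Hline : forall s, t <= s -> x s = y - (s - t)).
  { intros s Hs. destruct (nfloor_ex ((s - t) / tau)) as [m Hf].
    { apply Rdiv_le_0_compat; lra. }
    apply (Hm (S m)). split; [exact Hs |]. rewrite S_INR.
    assert (s - t <= (INR m + 1) * tau); [| lra].
    replace (s - t) with ((s - t) / tau * tau) by (field; lra).
    apply Rmult_le_compat_r; lra. }
  split.
  - rewrite (ensemble_ext _ (fun s => 0 < s <= t /\ switching tau x s));
      [exact (state_count HS x v Hx) |].
    intros s; split; [| intros []; assumption].
    intros [Hs Hc]. split; [| split; assumption]. split.
    + destruct (Req_dec s 0) as [-> | Hne]; [| lra].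
      exfalso; apply Hsw0; split; assumption.
    + apply Rnot_lt_le; intros Hlt. revert Hc. apply Hno; [| lra].
      destruct (Rle_dec (s - tau) t); [left; assumption |].
      right. rewrite Hline; lra.
  - apply is_lim_ext_loc with (f := fun s => y + t - s).
    + exists t. intros s Hs. rewrite Hline; lra.
    + intros P [M HP]. exists (y + t - M). intros s Hs. apply HP. lra.
Qed.

(** * The thresholds *)

(** The factors [2 * 4 ^ k + 1], [8 * 4 ^ k + 1] and [4 * 4 ^ k - 1] are positive,
    so comparing [tau] with the thresholds amounts to the signs of the four
    quantities on which the run depends. *)
Lemma threshold_gaps (tau : R) (k : nat) :
  3 * peak tau k = (2 * 4 ^ k + 1) * (tau - tau_ k) /\
  3 * (4 * peak tau k + 1 - tau) = (8 * 4 ^ k + 1) * (tau - theta_ k) /\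
  3 * (tau - 2 * peak tau k - 1) = (4 * 4 ^ k - 1) * (zeta_ k - tau) /\
  3 * (4 * peak tau k - tau) = (8 * 4 ^ k + 1) * (tau - tau_ (k + 1)).
Proof.
  assert (Hu : 1 <= 4 ^ k) by (apply pow_R1_Rle; lra).
  unfold peak, amplitude, tau_, theta_, zeta_.
  rewrite !pow_add, !pow_1. generalize dependent (4 ^ k). intros u Hu.
  repeat split; field; lra.
Qed.

Lemma threshold_order (k : nat) : (1 <= k)%nat ->
  1 < tau_ k /\ tau_ k < theta_ k /\ theta_ k < zeta_ k /\ zeta_ k < tau_ (k + 1) /\
  tau_ (k + 1) < 3 / 2.
Proof.
  intros Hk.
  assert (Hu : 4 <= 4 ^ k).
  { rewrite <- (pow_1 4) at 1. apply Rle_pow; [lra | exact Hk]. }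
  unfold tau_, theta_, zeta_.
  rewrite !pow_add, !pow_1. generalize dependent (4 ^ k). intros u Hu.
  repeat split; apply Rlt_0_minus.
  - replace (3 * u / (2 * u + 1) - 1) with ((u - 1) / (2 * u + 1)) by (field; lra).
    apply Rdiv_lt_0_compat; nra.
  - replace (3 * (u * 4 - 1) / (2 * (u * 4) + 1) - 3 * u / (2 * u + 1))
      with (3 * (u - 1) / ((2 * u + 1) * (8 * u + 1))) by (field; lra).
    apply Rdiv_lt_0_compat; nra.
  - replace (3 * (2 * u - 1) / (u * 4 - 1) - 3 * (u * 4 - 1) / (2 * (u * 4) + 1))
      with (3 * (2 * u - 2) / ((4 * u - 1) * (8 * u + 1))) by (field; lra).
    apply Rdiv_lt_0_compat; nra.
  - replace (3 * (u * 4) / (2 * (u * 4) + 1) - 3 * (2 * u - 1) / (u * 4 - 1))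
      with (3 / ((4 * u - 1) * (8 * u + 1)) * (2 * u + 1)) by (field; lra).
    apply Rmult_lt_0_compat; [apply Rdiv_lt_0_compat |]; nra.
  - replace (3 / 2 - 3 * (u * 4) / (2 * (u * 4) + 1)) with (3 / (2 * (8 * u + 1)))
      by (field; lra).
    apply Rdiv_lt_0_compat; nra.
Qed.

Lemma gap_sign (a d g : R) : 0 < a -> 3 * g = a * d ->
  (0 < d -> 0 < g) /\ (d = 0 -> g = 0) /\ (d < 0 -> g < 0).
Proof. intros Ha E. repeat split; intros Hd; nra. Qed.

Lemma starting_swings (tau : R) (k : nat) (x v : R -> R) :
  1 < tau < 3 / 2 -> 0 < peak tau k -> starting tau x v ->
  exists t, 0 < t /\ swing tau (starting tau) 1 1 t (peak tau k) (2 * k + 1).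
Proof.
  intros Htau Hk Hx. apply (swings_to_peak _ _ 1 1 0 0 k); try lra.
  - exact (starting_motions tau x v Hx).
  - left; lra.
  - replace (1 - 1) with 0 by ring. apply starting_state; lra.
Qed.

(** The second half starts at height 1 and is the reflection of the first. *)
Lemma period_at_tau (tau : R) (k : nat) (x v : R -> R) :
  1 < tau < 3 / 2 -> (1 <= k)%nat -> peak tau k = 0 -> starting tau x v ->
  periodic_with_switchings tau x (4 * k + 2).
Proof.
  intros Htau Hk Hd Hx. assert (HF := starting_motions tau x v Hx).
  destruct k as [| k]; [lia |].
  destruct (half_period tau _ 1 1 0 0 k HF Htau) as (h & Hh & HS1);
    [left; lra | left; reflexivity | exact Hd | |].
  { replace (1 - 1) with 0 by ring. apply starting_state; lra. }
  destruct (half_period tau _ 0 (- 1) h (0 + 2 * S k + 1) k HF Htau) as (T & HT & HS2);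
    [right; lra | right; reflexivity | exact Hd | |].
  { replace (1 - 0) with 1 by ring. exact HS1. }
  apply (starting_periodic tau T _ x v); [lra | lra | | exact Hx].
  replace (4 * S k + 2)%nat with (0 + 2 * S k + 1 + 2 * S k + 1)%nat by lia.
  replace 1 with (- - 1) by ring. exact HS2.
Qed.

Theorem theorem1 :
  (forall k : nat, (1 <= k)%nat ->
    tau_ k < theta_ k /\ theta_ k < zeta_ k /\ zeta_ k < tau_ (k + 1)) /\
  (forall (tau : R) (phi x : R -> R),
    0 < tau -> initial_function tau phi -> is_solution tau phi x ->
    forall k : nat, (1 <= k)%nat ->
      (tau = tau_ k -> periodic_with_switchings tau x (4 * k + 2)) /\
      (tau_ k < tau < theta_ k ->
        periodic_with_switchings tau x (2 * k + 4)) /\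
      (tau = theta_ k -> goes_to_minus_infinity_after tau x (2 * k + 5)) /\
      (theta_ k < tau < zeta_ k ->
        periodic_with_switchings tau x (2 * k + 6)) /\
      (tau = zeta_ k -> goes_to_minus_infinity_after tau x (4 * k + 5)) /\
      (zeta_ k < tau < tau_ (k + 1) ->
        periodic_with_switchings tau x (2 * k + 4))).
Proof.
  split.
  { intros k Hk. destruct (threshold_order k Hk) as (_ & H1 & H2 & H3 & _). auto. }
  intros tau phi x Htau Hphi Hsol k Hk.
  destruct (solution_starting tau phi x Htau Hphi Hsol) as [[v Hx] Hsw0].
  assert (HF := starting_motions tau x v Hx).
  destruct (threshold_order k Hk) as (O0 & O1 & O2 & O3 & O4).
  assert (Hu : 1 <= 4 ^ k) by (apply pow_R1_Rle; lra).
  destruct (threshold_gaps tau k) as (G1 & G2 & G3 & G4).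
  apply gap_sign in G1; [| lra]. apply gap_sign in G2; [| lra].
  apply gap_sign in G3; [| lra]. apply gap_sign in G4; [| lra].
  assert (Hswings : tau_ k < tau < 3 / 2 ->
    exists t, 0 < t /\ swing tau (starting tau) 1 1 t (peak tau k) (2 * k + 1)).
  { intros Ht. apply (starting_swings tau k x v); [lra | apply G1; lra | exact Hx]. }
  assert (Hle : tau < 3 / 2 -> peak tau k < tau - 1).
  { intros Ht. rewrite <- peak_0. apply peak_lt; [exact Ht | lia]. }
  refine (conj _ (conj _ (conj _ (conj _ (conj _ _))))); intros Ht.
  - apply (period_at_tau tau k x v); [lra | exact Hk | apply G1; lra | exact Hx].
  - destruct Hswings as (t & Ht0 & HS); [lra |].
    assert (P1 : 0 < peak tau k) by (apply G1; lra).
    assert (P2 : 4 * peak tau k + 1 - tau < 0) by (apply G2; lra).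
    assert (P3 : 0 < tau - 2 * peak tau k - 1) by (apply G3; lra).
    apply return_below_theta in HS; [| assumption || lra ..].
    replace (2 * k + 4)%nat with (2 * k + 1 + 3)%nat by lia.
    apply (starting_periodic tau _ _ x v) in HS; [exact HS | lra | lra | exact Hx].
  - destruct Hswings as (t & Ht0 & HS); [lra |].
    assert (P1 : 0 < peak tau k) by (apply G1; lra).
    assert (P2 : 4 * peak tau k + 1 - tau = 0) by (apply G2; lra).
    apply escape_at_theta in HS; [| assumption || lra ..].
    replace (2 * k + 5)%nat with (2 * k + 1 + 4)%nat by lia.
    apply (falls_forever tau _ _ _ x v) in HS;
      [exact HS | lra | lra | exact Hx | exact Hsw0].
  - destruct Hswings as (t & Ht0 & HS); [lra |].
    assert (P1 : 0 < peak tau k) by (apply G1; lra).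
    assert (P2 : 0 < 4 * peak tau k + 1 - tau) by (apply G2; lra).
    assert (P3 : 0 < tau - 2 * peak tau k - 1) by (apply G3; lra).
    apply return_above_theta in HS; [| assumption || lra ..].
    replace (2 * k + 6)%nat with (2 * k + 1 + 5)%nat by lia.
    apply (starting_periodic tau _ _ x v) in HS; [exact HS | lra | lra | exact Hx].
  - destruct Hswings as (t & Ht0 & HS); [lra |].
    assert (P3 : tau - 2 * peak tau k - 1 = 0) by (apply G3; lra).
    destruct (escape_at_zeta tau _ t (2 * k + 1) k HF) as [t' HS'];
      [lra | lra | exact HS |].
    replace (4 * k + 5)%nat with (2 * k + 1 + 2 * k + 4)%nat by lia.
    apply (falls_forever tau _ _ _ x v) in HS';
      [exact HS' | lra | lra | exact Hx | exact Hsw0].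
  - destruct Hswings as (t & Ht0 & HS); [lra |].
    assert (P1 : 0 < peak tau k) by (apply G1; lra).
    assert (P3 : tau - 2 * peak tau k - 1 < 0) by (apply G3; lra).
    assert (P4 : 4 * peak tau k - tau < 0) by (apply G4; lra).
    assert (P5 := Hle ltac:(lra)).
    apply return_above_zeta in HS; [| assumption || lra ..].
    replace (2 * k + 4)%nat with (2 * k + 1 + 3)%nat by lia.
    apply (starting_periodic tau _ _ x v) in HS; [exact HS | lra | lra | exact Hx].
Qed.
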